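(* Let $d\ge 2$. Consider Brochette first-passage percolation on $\mathbb{Z}^d$ with passage-time distribution function $F$, and let $a\ge 0$ be the infimum of the support of the passage-time distribution. Assume that at least one of the following two assumptions holds: (i) $a>0$; (ii) $a=0$ and $F(t)\sim c\,t^{\beta}$ as $t\to 0^+$ (i.e. $F(t)/(c\,t^\beta)\to 1$), for some constants $\beta\ge 1$ and $c>0$. Then $$\mathbb{P}\big(\text{for all } x,y\in\mathbb{Z}^d,\text{ a geodesic from } x \text{ to } y \text{ exists}\big)=1.$$
   Context: Lattice and paths. $\mathbb{Z}^d$ is equipped with the edge set $\mathbb{E}^d=\{\{x,y\}: x,y\in\mathbb{Z}^d,\ \|x-y\|_1=1\}$. A path is a (finite or infinite) sequence of edges such that consecutive edges share exactly one endpoint; when $x=y$ the empty path from $x$ to $x$ is allowed. Brochette first-passage percolation. An integer line is the set of points of $\mathbb{Z}^d$ lying on a common axis-parallel line of $\mathbb{R}^d$ (a line $x+\mathbb{Z}e_i$ with $x\in\mathbb{Z}^d$ and $(e_1,\dots,e_d)$ the canonical basis). Let $\Delta$ be the set of all integer lines, and let $(\tau_\delta)_{\delta\in\Delta}$ be i.i.d. non-negative real random variables with common cumulative distribution function $F$. Each edge $e\in\mathbb{E}^d$ belongs to a unique integer line $\delta$ (the one containing both its endpoints), and its passage time is $\tau_e:=\tau_\delta$; so all edges on the same line share the same passage time. The number $a\ge 0$, the infimum of the support of the passage-time distribution, is characterized by $F(a+\varepsilon)>0$ and $F(a-\varepsilon)=0$ for all $\varepsilon>0$. Passage times and geodesics.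 The passage time of a path $\Gamma$ is $T(\Gamma)=\sum_{e\in\Gamma}\tau_e$. For $x,y\in\mathbb{Z}^d$, $T(x,y)=\inf_\Gamma T(\Gamma)$, the infimum being over all paths $\Gamma$ from $x$ to $y$. A path $\gamma$ from $x$ to $y$ is a geodesic from $x$ to $y$ if $T(\gamma)=T(x,y)$. *)

(* Defs.v *)
From HB Require Import structures.
From mathcomp Require Import all_boot all_order all_algebra finmap.
From mathcomp Require Import all_classical all_reals all_analysis.
From mathcomp Require Import zify.

Set Implicit Arguments.
Unset Strict Implicit.
Unset Printing Implicit Defensive.

Import Order.TTheory GRing.Theory Num.Theory.
Import numFieldNormedType.Exports.

Local Open Scope classical_set_scope.
Local Open Scope ring_scope.

Definition vertex (d : nat) := 'rV[int]_d.

Definition norm1 (d : nat) (x : vertex d) : int := \sum_(i < d) `|x 0 i|.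

(* [line d] and [edge d] are types of sets of points, so that two descriptions
   of the same line (or of the same unoriented edge) are equal. *)
Definition axis_line (d : nat) (x : vertex d) (i : 'I_d) : set (vertex d) :=
  [set y | exists k : int, y = x + k *: delta_mx 0 i].

Definition lines (d : nat) : set (set (vertex d)) :=
  [set L | exists x i, L = axis_line x i].

Definition line (d : nat) := set_type (@lines d).

Definition edges (d : nat) : set (set (vertex d)) :=
  [set e | exists x y : vertex d, norm1 (x - y) = 1 /\ e = [set x; y]].

Definition edge (d : nat) := set_type (@edges d).

Lemma norm1_eq1 (d : nat) (x : vertex d) :
  norm1 x = 1 -> exists i (k : int), k != 0 /\ x = k *: delta_mx 0 i.
Proof.
move=> x1; have [i xi0] : exists i, x 0 i != 0.
  apply: contrapT => /forallNP x0; move: x1; rewrite /norm1 big1 // => i _.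
  by have /negP/negPn/eqP-> := x0 i; rewrite normr0.
exists i, (x 0 i); split => //; apply/rowP => j; rewrite !mxE eqxx /=.
have [->|ji] := eqVneq j i; first by rewrite mulr1.
rewrite mulr0; move: x1; rewrite /norm1 (bigD1 i) //= (bigD1 j) //=.
set s := \sum_(_ < _ | _) _; have s0 : 0 <= s by apply: sumr_ge0.
by move: xi0; move: (x 0 i) (x 0 j) => u v; lia.
Qed.

Lemma axis_line_sym (d : nat) (x u : vertex d) i :
  axis_line x i u -> axis_line x i = axis_line u i.
Proof.
move=> [k ->]; apply/seteqP; split => y [l ->].
  by exists (l - k); rewrite -addrA -scalerDl [k + _]addrC subrK.
by exists (k + l); rewrite -addrA -scalerDl.
Qed.

Lemma edge_line (d : nat) (e : edge d) :
  exists! L : line d, val e `<=` val L.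
Proof.
case: e => e /= /set_mem [x [y [xy1 ->{e}]]].
have [i [k [k0 xyE]]] := norm1_eq1 xy1.
have yx : axis_line y i x by exists k; rewrite -xyE addrC subrK.
have lineL : axis_line y i \in @lines d by apply/mem_set; exists y, i.
exists (SigSub lineL); split => /=.
  by move=> z [->//|->]; exists 0; rewrite scale0r addr0.
move=> [L' /= hL'] xyL'; apply: val_inj => /=.
have [z [j L'E]] := set_mem hL'; subst L'.
have zx := xyL' x (or_introl erefl); have zy := xyL' y (or_intror erefl).
rewrite (axis_line_sym zy) in zx *; case: zx => l xE.
have klE : k *: delta_mx 0 i = l *: delta_mx 0 j :> vertex d.
  by rewrite -xyE xE addrAC subrr add0r.
have [->//|ij] := eqVneq i j.
move/rowP : klE => /(_ i); rewrite !mxE !eqxx /= (negbTE ij) mulr1 mulr0 => k0'.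
by rewrite k0' eqxx in k0.
Qed.

Definition line_of (d : nat) (e : edge d) : line d :=
  projT1 (cid (edge_line e)).

Definition share_one_endpoint (d : nat) (e f : edge d) : Prop :=
  exists v, val e `&` val f = [set v].

Fixpoint joins (d : nat) (x : vertex d) (G : seq (edge d)) (y : vertex d) : Prop :=
  if G is e :: G' then exists z, val e = [set x; z] /\ joins z G' y else x = y.

(* [joins] excludes sequences such as three edges of a star, whose
   consecutive edges meet in one point but which are not traversed in order;
   the other conjunct excludes immediate backtracking. *)
Definition path_from_to (d : nat) (x y : vertex d) : set (seq (edge d)) :=
  [set G | sorted (fun e f => `[< share_one_endpoint e f >]) G /\ joins x G y].

Section probability.
Context {disp : measure_display} {Omega : measurableType disp} {R : realType}.
Variable P : probability Omega R.

Definition mutually_independent (I : choiceType) (X : I -> {RV P >-> R}) : Prop :=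
  forall (J : {fset I}) (B : I -> set R),
    (forall i, i \in J -> measurable (B i)) ->
    (P (\bigcap_(i in [set` J]) (X i @^-1` B i)) =
     \prod_(i <- J) P (X i @^-1` B i))%E.

Variables (d : nat) (tau : line d -> {RV P >-> R}).

Definition passage_time (G : seq (edge d)) (w : Omega) : R :=
  \sum_(e <- G) tau (line_of e) w.

Definition first_passage_time (x y : vertex d) (w : Omega) : R :=
  inf [set passage_time G w | G in path_from_to x y].

Definition geodesic (x y : vertex d) (w : Omega) (G : seq (edge d)) : Prop :=
  path_from_to x y G /\ passage_time G w = first_passage_time x y w.

End probability.

(* Main.v *)
(* Both assumptions give F(t) <= K t near 0, and this is all that is used.  The
   main step is that, for some eps > 0, almost surely no vertex is the starting
   point of arbitrarily long walks of cost at most eps.  Restarting from the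
   finitely many points where the budget eps is exhausted, walks of bounded cost
   then have bounded length, so an optimal path is chosen among finitely many.

   For the main step, sort the lines into classes by dyadic thresholds of their
   passage time: class c has probability at most K sg(c) with sg(c) = s0 / 2^c,
   and class k gathers all the faster lines.  Walks of cost at most
   eps are arbitrarily long only if some reach class k, for every k.  A plain first
   moment fails because a walk may return to the lines it has used.  So a walk is encoded by a
   chain of pairwise distinct, hence independent, lines, each jump being charged
   to a fresh line whose class exceeds those of the lines it gives access to
   again.  Weighting a chain by exp(- lam cost), a fresh line of class c and all
   its jumps contribute O(K / lam); a potential absorbs the number of available
   lines, so the sum over chains is O(1) when lam is a large multiple of k.  Thus
   class k is reached with probability O(exp(lam eps) 2^-k), which tends to 0
   for eps small. *)

Require Import Defs.
From HB Require Import structures.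
From mathcomp Require Import all_boot all_order all_algebra finmap.
From mathcomp Require Import all_classical all_reals all_analysis.
From mathcomp Require Import measurable_realfun zify ring lra.

Import Order.TTheory GRing.Theory Num.Theory.
Import numFieldNormedType.Exports.

Local Open Scope classical_set_scope.
Local Open Scope ring_scope.

Set Implicit Arguments.
Unset Strict Implicit.
Unset Printing Implicit Defensive.

(** * Walks *)

Section Walks.
Variable d : nat.
Implicit Types (x y z : vertex d) (st : 'I_d * bool) (s : seq ('I_d * bool)).

Lemma axis_line_in (x : vertex d) (i : 'I_d) : axis_line x i \in @lines d.
Proof. by apply/mem_set; exists x, i. Qed.

Definition line_through (x : vertex d) (i : 'I_d) : line d :=
  SigSub (axis_line_in x i).

(** The boolean selects the negative direction. Walks from a point are thus words over a finite
    alphabet, and only finitely many have a given length. *)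
Definition step (x : vertex d) (st : 'I_d * bool) : vertex d :=
  x + (-1) ^+ st.2 *: delta_mx 0 st.1.

Fixpoint walk_lines (x : vertex d) (s : seq ('I_d * bool)) : seq (line d) :=
  if s is st :: s' then line_through x st.1 :: walk_lines (step x st) s'
  else [::].

Lemma line_through_eq x y i : axis_line x i y -> line_through x i = line_through y i.
Proof. by move=> xy; apply: val_inj => /=; exact: axis_line_sym. Qed.

Lemma line_through_step x st : line_through (step x st) st.1 = line_through x st.1.
Proof. by apply/esym/line_through_eq; exists ((-1) ^+ st.2). Qed.

Lemma walk_lines_cat x s1 s2 :
  walk_lines x (s1 ++ s2) = walk_lines x s1 ++ walk_lines (foldl step x s1) s2.
Proof. by elim: s1 x => //= st s1 IH x; rewrite IH. Qed.

Lemma size_walk_lines x s : size (walk_lines x s) = size s.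
Proof. by elim: s x => //= st s IH x; rewrite IH. Qed.

Lemma step_coord_dist x st j : `|step x st 0 j - x 0 j| <= 1.
Proof.
rewrite !mxE eqxx /= [x 0 j + _]addrC addrK normrM normrX normrN1 expr1n mul1r.
by case: (j == _).
Qed.

Lemma foldl_step_coord_dist x s j :
  `|foldl step x s 0 j - x 0 j| <= (size s)%:Z.
Proof.
elim: s x => [|st s IH] x /=; first by rewrite subrr.
have := IH (step x st); have := step_coord_dist x st j.
by move: (foldl step (step x st) s 0 j) (step x st 0 j) (x 0 j) => u v t; lia.
Qed.

Lemma norm1_delta (k : int) (i : 'I_d) :
  norm1 (k *: delta_mx 0 i : vertex d) = `|k|.
Proof.
rewrite /norm1 (bigD1 i) //= big1 ?addr0; first by rewrite !mxE !eqxx mulr1.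
by move=> j /negbTE ji; rewrite !mxE ji andbF mulr0 normr0.
Qed.

Lemma norm1_opp x : norm1 (- x) = norm1 x.
Proof. by apply: eq_bigr => i _; rewrite mxE normrN. Qed.

Lemma step_edge x st : [set x; step x st] \in @edges d.
Proof.
apply/mem_set; exists x, (step x st); split => //.
by rewrite -norm1_opp opprB /step addrAC subrr add0r norm1_delta normrX normrN1 expr1n.
Qed.

Definition edge_of_step x st : edge d := SigSub (step_edge x st).

Fixpoint walk_edges x s : seq (edge d) :=
  if s is st :: s' then edge_of_step x st :: walk_edges (step x st) s' else [::].

Lemma line_of_edge_of_step x st : line_of (edge_of_step x st) = line_through x st.1.
Proof.
rewrite /line_of; case: cid => L /= [_ uL]; apply: uL => /= z.
case=> ->; first by exists 0; rewrite scale0r addr0.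
by exists ((-1) ^+ st.2).
Qed.

Lemma set2_eqP (T : Type) (a b c e : T) : [set a; b] = [set c; e] ->
  (a = c /\ b = e) \/ (a = e /\ b = c).
Proof.
move=> E.
have ha : [set c; e] a by rewrite -E; left.
have hb : [set c; e] b by rewrite -E; right.
have hc : [set a; b] c by rewrite E; left.
have he : [set a; b] e by rewrite E; right.
case: ha => /= ?; case: hb => /= ?; subst; auto.
- by case: he => ->; auto.
- by case: hc => ->; auto.
Qed.

Lemma norm1_step x y : norm1 (y - x) = 1 -> exists st, y = step x st.
Proof.
move=> xy; have [i [k [_ xyE]]] := norm1_eq1 xy.
have k1 : `|k| = 1 by rewrite -xy xyE norm1_delta.
exists (i, k == -1); rewrite /step /=.
have -> : (-1) ^+ (k == -1) = k.
  by case: eqP => [->|]; rewrite ?expr1 // expr0; lia.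
by rewrite -xyE addrCA subrr addr0.
Qed.

Lemma edge_from (e : edge d) x z : val e = [set x; z] -> exists st, z = step x st.
Proof.
case: e => e /= he eE; have [u [v [uv]]] := set_mem he.
rewrite {}eE => xzuv; case: (set2_eqP xzuv) => -[-> ->].
- by apply: norm1_step; rewrite -norm1_opp opprB.
- exact: norm1_step.
Qed.

Lemma joinsP x G y :
  joins x G y <-> exists2 s, G = walk_edges x s & foldl step x s = y.
Proof.
split.
- elim: G x => [|e G IH] x /=; first by move=> <-; exists [::].
  move=> [z [ez /IH[s -> <-]]]; have [st zE] := edge_from ez.
  exists (st :: s); rewrite /= -zE //.
  by have -> : e = edge_of_step x st by apply: val_inj; rewrite /= ez zE.
- case=> s -> <- {G y}; elim: s x => //= st s IH x.
  by exists (step x st).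
Qed.

Definition nonbacktracking (x : vertex d) s :=
  sorted (fun e f => `[< share_one_endpoint e f >]) (walk_edges x s).

Lemma path_from_toP x y G : path_from_to x y G <->
  exists s, [/\ nonbacktracking x s, foldl step x s = y & G = walk_edges x s].
Proof.
split; first by move=> [sG /joinsP[s GE <-]]; exists s; rewrite /nonbacktracking -GE.
by move=> [s [bs sy ->]]; split=> //; apply/joinsP; exists s.
Qed.

Lemma share_one_endpoint_step x st st' : step (step x st) st' != x ->
  share_one_endpoint (edge_of_step x st) (edge_of_step (step x st) st').
Proof.
move=> ne; exists (step x st); apply/seteqP; split => z /=; last first.
  by move=> ->; split; [right|left].
move=> [[->|->//]] [xE|xE].
- exact: xE.
- by rewrite -xE eqxx in ne.
Qed.

(** A step that leads back to the vertex visited two steps earlier can be deleted together with its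
    predecessor; without such a step, consecutive edges share a single endpoint. *)
Lemma nonbacktracking_or_shorten x s : nonbacktracking x s \/
  exists2 s', (size s' < size s)%N & foldl step x s' = foldl step x s.
Proof.
elim: s x => [|st [|st' s] IH] x; [by left|by left|].
have [E|ne] := eqVneq (step (step x st) st') x.
  by right; exists s => //=; rewrite E.
have [bs|[s' ss sE]] := IH (step x st).
  by left; apply/andP; split => //; apply/asboolP; exact: share_one_endpoint_step.
by right; exists (st :: s').
Qed.

Lemma foldl_step_nseq x i b n :
  foldl step x (nseq n (i, b)) = x + ((-1) ^+ b *+ n) *: delta_mx 0 i.
Proof.
elim: n x => [|n IH] x /=; first by rewrite mulr0n scale0r addr0.
by rewrite IH /step /= mulrS scalerDl addrA.
Qed.

Lemma walk_exists x y : exists s, foldl step x s = y.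
Proof.
(* Coordinates are corrected one axis at a time, along the list [r]. *)
suff H (r : seq 'I_d) : exists s,
    foldl step x s = x + \sum_(i <- r) (y - x) 0 i *: delta_mx 0 i.
  have [s sE] := H (index_enum 'I_d); exists s; rewrite sE.
  by rewrite -[in RHS](subrK x y) addrC [in RHS](row_sum_delta (y - x)).
elim: r => [|i r [s IH]]; first by exists [::]; rewrite /= big_nil addr0.
set k := (y - x) 0 i.
exists (s ++ nseq `|k|%N (i, k < 0)).
rewrite foldl_cat IH foldl_step_nseq big_cons -/k [in RHS]addrCA [RHS]addrC.
congr (_ + _ *: _).
by case: (ltP k 0) => h; rewrite ?expr1 ?expr0; lia.
Qed.

Lemma nonbacktracking_exists x y :
  exists2 s, nonbacktracking x s & foldl step x s = y.
Proof.
suff H n s : (size s < n)%N -> foldl step x s = y ->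
    exists2 s, nonbacktracking x s & foldl step x s = y.
  by have [s sy] := walk_exists x y; exact: (H (size s).+1 s).
elim: n s => // n IH s sn sy.
have [bs|[s' ss sE]] := nonbacktracking_or_shorten x s; first by exists s.
by apply: (IH s'); [exact: leq_trans ss _|rewrite sE].
Qed.

End Walks.
Arguments step {d}.

(** * Costs of walks and existence of a cheapest walk *)

Section WalkCost.
Variables (R : realType) (d : nat) (t : line d -> R).
Hypothesis t_ge0 : forall L, 0 <= t L.
Implicit Types (x y : vertex d) (s : seq ('I_d * bool)).

Definition walk_cost x s : R := \sum_(L <- walk_lines x s) t L.

Lemma walk_cost_cat x s1 s2 :
  walk_cost x (s1 ++ s2) = walk_cost x s1 + walk_cost (foldl step x s1) s2.
Proof. by rewrite /walk_cost walk_lines_cat big_cat. Qed.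

Lemma walk_cost_ge0 x s : 0 <= walk_cost x s.
Proof. exact: sumr_ge0. Qed.

Lemma walk_cost_ge_size x s (q : R) :
  (forall L, L \in walk_lines x s -> q <= t L) -> q * (size s)%:R <= walk_cost x s.
Proof.
move=> qt; rewrite -(size_walk_lines x) /walk_cost -sum1_size natr_sum mulr_sumr.
by rewrite big_seq [leRHS]big_seq; apply: ler_sum => L /qt; rewrite mulr1.
Qed.

(* [eps] does not depend on [x], so that the argument can be restarted from the
   finitely many points where the walk first exceeds cost [eps]. *)
Lemma bounded_size (eps : R) : 0 < eps ->
  (forall x, exists n, forall s, walk_cost x s <= eps -> (size s <= n)%N) ->
  forall (M : R) x, exists n, forall s, walk_cost x s <= M -> (size s <= n)%N.
Proof.
move=> eps0 H M; suff {M} Hj (j : nat) x : exists n, forall s,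
    walk_cost x s <= j%:R * eps -> (size s <= n)%N.
  move=> x; have [n nP] := Hj (Num.bound `|M / eps|) x.
  exists n => s sM; apply/nP/(le_trans sM); rewrite -ler_pdivrMr //.
  by rewrite (le_trans (ler_norm _))// ltW // archi_boundP.
elim: j x => [|j IH] x.
  by have [n nP] := H x; exists n => s; rewrite mul0r => /le_trans/(_ (ltW eps0))/nP.
have [n nP] := H x; have [f fP] := choice IH.
exists (n.+1 + \max_(u : n.+1.-tuple ('I_d * bool)) f (foldl step x u))%N => s.
have [sn _|ns] := leqP (size s) n; first by rewrite (leq_trans sn)// -addn1 -addnA leq_addr.
rewrite -{1}(cat_take_drop n.+1 s) walk_cost_cat => cs.
have su : size (take n.+1 s) == n.+1 by rewrite size_takel.
have cu : eps < walk_cost x (take n.+1 s).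
  by rewrite ltNge; apply/negP => /nP; rewrite (eqP su) ltnn.
have := fP (foldl step x (take n.+1 s)) (drop n.+1 s).
rewrite size_drop => /(_ _)/wrap[|sd].
  by move: cs; rewrite -natr1 mulrDl mul1r; lra.
rewrite -leq_subLR (leq_trans sd) //.
exact: (leq_bigmax (Tuple su)).
Qed.

(** Competitors no costlier than [s0] live in the finite type of words of length at most [n]; all
    others lose to [s0]. *)
Lemma cheapest_walk_exists x y (n : nat) s0 :
  nonbacktracking x s0 -> foldl step x s0 = y ->
  (forall s, walk_cost x s <= walk_cost x s0 -> (size s <= n)%N) ->
  exists s, [/\ nonbacktracking x s, foldl step x s = y &
    forall s', nonbacktracking x s' -> foldl step x s' = y ->
      walk_cost x s <= walk_cost x s'].
Proof.
move=> bs0 sy0 nP.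
pose ok (u : n.-bseq ('I_d * bool)) :=
  `[< nonbacktracking x u /\ foldl step x u = y >].
pose u0 : n.-bseq ('I_d * bool) := Bseq (nP _ (lexx _)).
have ok0 : ok u0 by apply/asboolP.
case: (Order.TotalTheory.arg_minP (fun u : n.-bseq _ => walk_cost x u) ok0) => u /asboolP[bu uy] umin.
exists u; split => // s' bs' sy'.
have [le|gt] := leP (walk_cost x s') (walk_cost x s0).
  by apply: (umin (Bseq (nP _ le))); apply/asboolP.
by apply: ltW; apply: le_lt_trans gt; exact: (umin u0).
Qed.

End WalkCost.

(** * Chains of distinct lines *)

Section LinePoints.
Variable d : nat.

Lemma line_axis (A : line d) :
  exists pi : vertex d * 'I_d, val A = axis_line pi.1 pi.2.
Proof. by case: A => A /= /set_mem [p [i ->]]; exists (p, i). Qed.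

Definition line_base (A : line d) := (projT1 (cid (line_axis A))).1.

Definition line_dir (A : line d) := (projT1 (cid (line_axis A))).2.

(** A point of [A] is determined by its coordinate along [A], so one integer encodes the landing
    point of a jump. *)
Definition point_at (A : line d) (z : int) : vertex d :=
  line_base A + (z - line_base A 0 (line_dir A)) *: delta_mx 0 (line_dir A).

Lemma point_atK (A : line d) (y : vertex d) :
  val A y -> point_at A (y 0 (line_dir A)) = y.
Proof.
rewrite /point_at /line_base /line_dir; case: cid => -[p i] /= -> [l ->].
by rewrite !mxE !eqxx mulr1 addrAC subrr add0r.
Qed.

End LinePoints.

Section Chains.
Variables (R : realType) (d k : nat) (sg : nat -> R).
Implicit Types (x y : vertex d) (s : seq ('I_d * bool)) (h : seq (line d * nat)).

(** A jump stands for a nonempty piece of walk, hence the maximum with 1, and a coordinate moves by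
    at most 1 per step, hence [|z|]. *)
Definition jump_cost (c : nat) (z : int) : R := sg c * (maxn 1 `|z|)%:R.

Fixpoint lower_prefix (c : nat) h : seq (line d) :=
  if h is p :: h' then if (p.2 < c)%N then p.1 :: lower_prefix c h' else [::]
  else [::].

(* [h] lists the lines already used, most recent first, with their classes.  A
   chain jumps from [x] along a fresh line [L], but lands on a point of any line
   [A] used after the last line whose class is at least that of [L]: the walk
   may have come back to [A] thanks to [L].  It ends on a line of class [k];
   [b] is the remaining budget and [m] bounds the number of jumps. *)
Fixpoint reach (cl : line d -> nat) (m : nat) h (x : vertex d) (b : R) : Prop :=
  0 <= b /\
  ((exists2 i, line_through x i \notin unzip1 h & cl (line_through x i) = k) \/
   if m is m'.+1 then
     exists i, let L := line_through x i in
     [/\ L \notin unzip1 h, (cl L < k)%N &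
      exists A z, A \in L :: lower_prefix (cl L) h /\
        reach cl m' ((L, cl L) :: h) (point_at A (x 0 (line_dir A) + z))
          (b - jump_cost (cl L) z)]
   else False).

Lemma reach_mono cl m m' h x b b' : (m <= m')%N -> b <= b' ->
  reach cl m h x b -> reach cl m' h x b'.
Proof.
elim: m m' h x b b' => [|m IH] [|m'] h x b b' // mm' bb' [b0 [end_|]] //=; 
  try by split; [exact: le_trans bb'|left].
move=> [i [Lh Lk [A [z [AL r]]]]].
split; first exact: le_trans bb'.
right; exists i; split => //; exists A, z; split => //.
by apply: IH r => //; rewrite lerB.
Qed.

Variables (t : line d -> R) (cl : line d -> nat).
Hypothesis sg_ge0 : forall c, 0 <= sg c.
Hypothesis sg_noninc : forall c c', (c <= c')%N -> sg c' <= sg c.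
Hypothesis cl_sg : forall L, (cl L < k)%N -> sg (cl L) <= t L.

Lemma split_first (p : pred (line d)) x s : has p (walk_lines x s) ->
  exists s1 st s2, [/\ s = s1 ++ st :: s2, p (line_through (foldl step x s1) st.1)
    & all (predC p) (walk_lines x s1)].
Proof.
elim: s x => //= st s IH x; case: (boolP (p _)) => /= [px _|npx /IH].
  by exists [::], st, s.
move=> [s1 [st' [s2 [-> ps2 ps1]]]]; exists (st :: s1), st', s2; split => //=.
by rewrite npx.
Qed.

Lemma split_last (p : pred (line d)) x s : has p (walk_lines x s) ->
  exists s1 st s2, [/\ s = s1 ++ st :: s2, p (line_through (foldl step x s1) st.1)
    & all (predC p) (walk_lines (step (foldl step x s1) st) s2)].
Proof.
elim: s x => //= st s IH x.
have [/IH[s1 [st' [s2 [-> ps2 ps1]]]] _|hs] := boolP (has p (walk_lines (step x st) s)).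
  by exists (st :: s1), st', s2.
by rewrite orbF => px; exists [::], st, s; split => //=; rewrite all_predC.
Qed.

Lemma max_class_line (l : seq (line d)) : l != [::] ->
  exists2 L, L \in l & forall L', L' \in l -> (cl L' <= cl L)%N.
Proof.
elim: l => // L [|L1 l] IH _.
  by exists L; rewrite ?mem_head // => L'; rewrite inE => /eqP ->.
have [//|L2 L2l L2max] := IH.
have [le|lt] := leqP (cl L2) (cl L).
  exists L; rewrite ?mem_head // => L'; rewrite inE => /predU1P[->//|/L2max].
  by move=> /leq_trans; apply.
exists L2; first by rewrite inE L2l orbT.
by move=> L'; rewrite inE => /predU1P[->|/L2max//]; exact: ltnW.
Qed.

Lemma lower_prefix_cat c (N : seq (line d)) h :
  (forall L, L \in N -> (cl L < c)%N) ->
  {subset N <= lower_prefix c ([seq (L, cl L) | L <- N] ++ h)}.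
Proof.
elim: N => // L N IH H L' /=; rewrite H ?mem_head // !inE => /predU1P[->|L'N].
  by rewrite eqxx.
by rewrite IH ?orbT // => L'' L''N; apply: H; rewrite inE L''N orbT.
Qed.

Lemma unzip1_classes (N : seq (line d)) : unzip1 [seq (L, cl L) | L <- N] = N.
Proof. by rewrite /unzip1 -map_comp map_id. Qed.

(* Split the walk at its first visit to a line [L] of maximal class and at its
   last visit to a line recorded by then.  The part in between costs at least
   the jump, because [L] has the smallest passage time, up to its class; the
   two other parts are encoded recursively, by disjoint sets of lines. *)
Lemma walk_chain s x h :
  (forall L, L \in walk_lines x s -> (cl L < k)%N /\ L \notin unzip1 h) ->
  exists2 N : seq (line d), {subset N <= walk_lines x s} &
    forall m b, reach cl m ([seq (L, cl L) | L <- N] ++ h) (foldl step x s) b ->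
      reach cl (size s + m) h x (b + walk_cost t x s).
Proof.
have [n] := ubnP (size s); elim: n s x h => // n IH s x h.
have [->|s_nil] := eqVneq s [::].
  by move=> _ _; exists [::] => // m b /=; rewrite /walk_cost big_nil addr0.
rewrite ltnS => sn hs.
have [|L0 L0s L0max] := @max_class_line (walk_lines x s).
  by rewrite -size_eq0 size_walk_lines size_eq0.
pose c := cl L0.
have [|s1 [st [s2 [sE /eqP cL s1c]]]] := @split_first (fun L => cl L == c) x s.
  by apply/hasP; exists L0.
set w := foldl step x s1 in cL *; set L := line_through w st.1 in cL *.
have s1s : {subset walk_lines x s1 <= walk_lines x s}.
  by move=> L' L's1; rewrite sE walk_lines_cat mem_cat L's1.
have s1_lt L' : L' \in walk_lines x s1 -> (cl L' < c)%N.
  move=> L's1; rewrite ltn_neqAle L0max ?andbT ?s1s //.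
  exact: (allP s1c).
have sz1 : (size s1 < size s)%N by rewrite sE size_cat /= -addSnnS leq_addr.
have [||N1 N1s1 N1P] := IH s1 x h; first exact: leq_trans sz1 sn.
  by move=> L' /s1s/hs.
have [|s3 [st' [s4 [s2E AL s4P]]]] :=
    @split_last (fun L' => L' \in L :: N1) w (st :: s2).
  by rewrite /= mem_head.
set A := line_through _ _ in AL; set y := step (foldl step w s3) st' in s4P.
have sE' : s = s1 ++ s3 ++ st' :: s4 by rewrite sE s2E.
have s4s : {subset walk_lines y s4 <= walk_lines x s}.
  by move=> L' L's4; rewrite sE' !walk_lines_cat /= !mem_cat inE L's4 !orbT.
have s3s : {subset walk_lines w (rcons s3 st') <= walk_lines x s}.
  move=> L' L's3; rewrite sE' -cat_rcons !walk_lines_cat !mem_cat -/w L's3.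
  by rewrite orbT.
have Ls : L \in walk_lines x s.
  by rewrite sE walk_lines_cat mem_cat /= inE eqxx orbT.
(* After the last visit to [L :: N1] the walk avoids these lines, so they can join the history when
   the final part is encoded. *)
pose h' := (L, cl L) :: [seq (L, cl L) | L <- N1] ++ h.
have sz4 : (size s4 < size s)%N.
  by rewrite sE' !size_cat /= !addnS ltnS addnA leq_addl.
have [||N4 N4s4 N4P] := IH s4 y h'; first exact: leq_trans sz4 sn.
  move=> L' L's4; have [L'k L'h] := hs _ (s4s _ L's4); split => //.
  rewrite /h' /= /unzip1 map_cat -/(unzip1 _) unzip1_classes -/(unzip1 _).
  by rewrite -cat_cons mem_cat negb_or L'h andbT; exact: (allP s4P).
exists (N4 ++ L :: N1).
  move=> L'; rewrite mem_cat inE => /orP[/N4s4/s4s//|/predU1P[->//|/N1s1/s1s//]].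
move=> m b; rewrite map_cat /= -catA sE' -cat_rcons !foldl_cat -/w foldl_rcons -/y.
rewrite !walk_cost_cat -/w foldl_rcons -/y => /N4P r4.
pose z := y 0 (line_dir A) - w 0 (line_dir A).
have Ay : val A y.
  by rewrite /A -line_through_step -/y; exists 0; rewrite scale0r addr0.
have [Lk Lh] := hs _ Ls.
have cost3 : jump_cost (cl L) z <= walk_cost t w (rcons s3 st').
  apply: (@le_trans _ _ (sg (cl L) * (size (rcons s3 st'))%:R)).
    rewrite ler_wpM2l // ler_nat geq_max size_rcons /=.
    have := foldl_step_coord_dist w (rcons s3 st') (line_dir A).
    by rewrite foldl_rcons -/y size_rcons -/z; lia.
  apply: walk_cost_ge_size => L' /s3s L's.
  have [L'k _] := hs _ L's; apply: le_trans (cl_sg L'k).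
  by apply: sg_noninc; rewrite cL; exact: L0max.
have r3 : reach cl (size s4 + m).+1 ([seq (L, cl L) | L <- N1] ++ h) w
    (b + walk_cost t y s4 + jump_cost (cl L) z).
  split.
    have [b0 _] : 0 <= b + walk_cost t y s4 /\ True.
      by case: (size s4 + m)%N r4 => [|?] [].
    by rewrite addr_ge0 // mulr_ge0.
  right; exists st.1; rewrite -/L; split => //.
    rewrite /unzip1 map_cat -/(unzip1 _) unzip1_classes -/(unzip1 _) mem_cat.
    rewrite negb_or Lh andbT; apply/negP => /N1s1/s1_lt.
    by rewrite cL ltnn.
  exists A, z; split.
    move: AL; rewrite inE => /predU1P[->|AN1]; first exact: mem_head.
    rewrite inE lower_prefix_cat ?orbT // => L' /N1s1/s1_lt.
    by rewrite cL.
  by rewrite addrK /z addrCA subrr addr0 point_atK.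
apply: (@reach_mono _ (size s1 + (size s4 + m).+1) _ _ _
    (b + walk_cost t y s4 + jump_cost (cl L) z + walk_cost t x s1)).
- by rewrite !size_cat size_rcons; lia.
- by lra.
- exact: N1P.
Qed.

(** The walk is cut just before its first line of class [k]. The part kept uses only smaller
    classes, so [walk_chain] applies to it and [m] bounds its length, hence the number of jumps. *)
Lemma fast_line_reach x s (b : R) : (forall L, (cl L <= k)%N) ->
  (forall L, 0 <= t L) -> walk_cost t x s <= b ->
  (exists2 L, L \in walk_lines x s & cl L = k) ->
  forall m, (forall s1, walk_cost t x s1 <= b ->
    (forall L, L \in walk_lines x s1 -> (cl L < k)%N) -> (size s1 <= m)%N) ->
  reach cl m [::] x b.
Proof.
move=> clk t0 sb [L Ls Lk] m mP.
have [|s1 [st [s2 [sE /eqP cL s1c]]]] := @split_first (fun L => cl L == k) x s.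
  by apply/hasP; exists L; rewrite ?Lk.
have s1k L' : L' \in walk_lines x s1 -> (cl L' < k)%N.
  by move=> L's1; rewrite ltn_neqAle clk andbT; exact: (allP s1c).
have s1b : walk_cost t x s1 <= b.
  apply: le_trans sb; rewrite sE walk_cost_cat lerDl.
  exact: walk_cost_ge0.
have [|N Ns1 NP] := @walk_chain s1 x [::]; first by move=> L' /s1k.
apply: (@reach_mono _ (size s1 + 0) _ _ _ (0 + walk_cost t x s1)).
- by rewrite addn0; exact: mP.
- by rewrite add0r.
apply: NP; split => //; left; exists st.1 => //.
rewrite cats0 unzip1_classes; apply/negP => /Ns1/s1k.
by rewrite cL ltnn.
Qed.

End Chains.

(** * A potential controlling the number of available lines *)

Section Potential.
Variables (R : realType) (d k : nat).
Hypothesis k_gt0 : (0 < k)%N.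
Implicit Types h : seq (line d * nat).

(** With this base a line weighs at most [r ^+ k <= expR 1], while lowering its exponent by one
    still gains a relative [1 / k]. *)
Let r : R := 1 + k%:R^-1.

(* Each line of [h] weighs [r ^ (k - M)], with [M] the largest class used since:
   the lines that a jump of class [c] makes available are those with [M < c],
   and their weights drop when [c] enters. *)
Fixpoint potential (M : nat) h : R :=
  if h is p :: h' then r ^+ (k - maxn M p.2) * potential (maxn M p.2) h' else 1.

Let r_ge1 : 1 <= r.
Proof. by rewrite lerDl invr_ge0. Qed.

Lemma potential_ge1 M h : 1 <= potential M h.
Proof.
elim: h M => //= p h IH M; rewrite -[leLHS]mulr1.
by apply: ler_pM => //; rewrite exprn_ege1.
Qed.

(** Raising the floor from [c] to [c.+1] divides by [r] the weight of exactly the lines whose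
    running maximum of classes is at most [c], and these form [lower_prefix c.+1 h]. *)
Lemma potential_succ c h : (c < k)%N ->
  r ^+ size (lower_prefix c.+1 h) * potential c.+1 h = potential c h.
Proof.
move=> ck; elim: h => [|p h IH] /=; first by rewrite mul1r.
have [pc|cp] := ltnP p.2 c.+1.
  rewrite (@maxn_idPl c _ pc) /= -IH -(subnSK ck) !exprS.
  by rewrite -!mulrA; congr (_ * _); rewrite mulrCA.
by rewrite mul1r (maxn_idPr (ltnW cp)).
Qed.

Lemma bernoulli (n : nat) : 1 + n%:R / k%:R <= r ^+ n.
Proof.
elim: n => [|n IH]; first by rewrite mul0r addr0 expr0.
have k0 : 0 <= k%:R^-1 :> R by rewrite invr_ge0.
rewrite exprS; apply: le_trans (ler_wpM2l (le_trans ler01 r_ge1) IH).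
rewrite /r -natr1; have : 0 <= n%:R * k%:R^-1 * k%:R^-1 :> R by rewrite !mulr_ge0.
by lra.
Qed.

(** Bernoulli's inequality turns the drop of the potential into a bound on the number of available
    lines. The right-hand sides telescope over [c]. *)
Lemma size_lower_prefix_potential c h : (c < k)%N ->
  (size (lower_prefix c.+1 h))%:R * potential c.+1 h <=
  k%:R * (potential c h - potential c.+1 h).
Proof.
move=> ck; rewrite -(potential_succ h ck).
set u := potential _ _; set n := size _.
have u0 : 0 <= u by rewrite (le_trans ler01)// potential_ge1.
have := ler_wpM2r u0 (bernoulli n); rewrite mulrDl mul1r => nu.
have k0 : 0 < k%:R :> R by rewrite ltr0n.
have -> : n%:R * u = k%:R * (n%:R / k%:R * u).
  by rewrite mulrA mulrCA mulfV ?mulr1 // gt_eqF.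
by rewrite ler_pM2l // lerBrDl.
Qed.

Lemma potential_nonincreasing c h : (c <= k)%N -> potential c h <= potential 0 h.
Proof.
elim: c => // c IH ck; apply: le_trans (IH (ltnW ck)).
rewrite -(potential_succ h ck) ler_peMl ?exprn_ege1 //.
by rewrite (le_trans ler01)// potential_ge1.
Qed.

Lemma sum_size_lower_prefix_potential h j : (j < k)%N ->
  \sum_(c < j.+1) (size (lower_prefix c h))%:R * potential c h <=
  k%:R * (potential 0 h - potential j h).
Proof.
elim: j => [|j IH] jk.
  by rewrite big_ord1 subrr mulr0; case: h => //= *; rewrite mul0r.
rewrite big_ord_recr /=; have := IH (ltnW jk).
by have := size_lower_prefix_potential h (ltnW jk); lra.
Qed.

(** The sum runs over the class of a fresh line and the lines it may land on, the successor counting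
    [L] itself. The weight of [L] costs [expR 1]; the older lines telescope to [k] potentials, and
    [L] as a landing line accounts for [k] more. *)
Lemma sum_potential_cons (L : line d) h :
  \sum_(c < k) (size (lower_prefix c h)).+1%:R * potential 0 ((L, val c) :: h) <=
  2 * expR 1 * k%:R * potential 0 h.
Proof.
have pot0 c : 0 <= potential c h by rewrite (le_trans ler01)// potential_ge1.
have rk (c : nat) : r ^+ (k - c) <= expR 1.
  apply: (@le_trans _ _ (r ^+ k)).
    by apply: ler_weXn2l => //; exact: leq_subr.
  apply: (@le_trans _ _ (expR k%:R^-1 ^+ k)).
    by rewrite ler_pXn2r ?nnegrE ?expR_ge0 ?(le_trans ler01) // expR_ge1Dx.
  by rewrite -expRM_natl mulfV // pnatr_eq0 -lt0n.
apply: (@le_trans _ _ (expR 1 * \sum_(c < k)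
    ((size (lower_prefix c h))%:R * potential c h + potential c h))).
  rewrite mulr_sumr; apply: ler_sum => c _ /=.
  rewrite max0n -[X in _ * (_ + X)]mul1r -mulrDl natr1 mulrCA.
  by rewrite ler_wpM2r // mulr_ge0.
rewrite -!mulrA [leRHS]mulrCA ler_pM2l ?expR_gt0 // big_split /=.
have [j jk] : exists j, k = j.+1 by exists k.-1; rewrite prednK.
have := sum_size_lower_prefix_potential h (j := j); rewrite -jk => /(_ _)/wrap[|H].
  by rewrite jk.
have : \sum_(c < k) potential c h <= \sum_(c < k) potential 0 h.
  by apply: ler_sum => c _; apply: potential_nonincreasing; exact: ltnW.
rewrite sumr_const card_ord -mulr_natl => H2.
have : 0 <= k%:R * potential j h by rewrite mulr_ge0.
by rewrite mulrBr in H; lra.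
Qed.

End Potential.

(** * Probability of reaching a fast line *)

Section ProbabilityBounds.
Context {disp : measure_display} {Omega : measurableType disp} {R : realType}.
Variable P : probability Omega R.

(* For sets that are not known to be measurable. *)
Definition prob_le (A : set Omega) (q : R) :=
  exists2 B, measurable B & A `<=` B /\ (P B <= q%:E)%E.

Lemma prob_leS A A' q : A `<=` A' -> prob_le A' q -> prob_le A q.
Proof. by move=> AA' [B mB [A'B Pq]]; exists B => //; split=> //; exact: subset_trans A'B. Qed.

Lemma prob_leW A q q' : q <= q' -> prob_le A q -> prob_le A q'.
Proof.
move=> qq' [B mB [AB Pq]]; exists B => //; split=> //.
by apply: le_trans Pq _; rewrite lee_fin.
Qed.

Lemma prob_le0 A q : A `<=` set0 -> 0 <= q -> prob_le A q.
Proof. by move=> A0 q0; exists set0 => //; split => //; rewrite measure0 lee_fin. Qed.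

Lemma prob_leU A A' q q' :
  prob_le A q -> prob_le A' q' -> prob_le (A `|` A') (q + q').
Proof.
move=> [B mB [AB Pq]] [B' mB' [AB' Pq']].
exists (B `|` B'); first exact: measurableU.
split; first exact: setUSS.
rewrite EFinD; apply: le_trans (leeD Pq Pq').
exact: measureU2.
Qed.

Lemma prob_le_bigU (T : eqType) (l : seq T) (A : T -> set Omega) (q : T -> R) :
  (forall i, i \in l -> prob_le (A i) (q i)) ->
  prob_le [set w | exists2 i, i \in l & A i w] (\sum_(i <- l) q i).
Proof.
elim: l => [|i l IH] Aq; first by rewrite big_nil; apply: prob_le0 => // w [].
rewrite big_cons; apply: (prob_leS (A' := A i `|` [set w | exists2 i, i \in l & A i w])).
  move=> w [j]; rewrite inE => /predU1P[->|jl] Aj; first by left.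
  by right; exists j.
apply: prob_leU; first exact/Aq/mem_head.
by apply: IH => j jl; apply: Aq; rewrite inE jl orbT.
Qed.

Lemma prob_independent_seq (I : choiceType) (X : I -> {RV P >-> R})
    (h : seq (I * nat)) (J : nat -> set R) (q : nat -> R) :
  mutually_independent X -> uniq (unzip1 h) -> (forall c, measurable (J c)) ->
  (forall i c, (P (X i @^-1` J c) <= (q c)%:E)%E) ->
  prob_le [set w | forall p, p \in h -> J p.2 (X p.1 w)] (\prod_(p <- h) q p.2).
Proof.
move=> indep uh mJ Jq.
(* Since the lines of [h] are distinct, this is [J c] for the unique entry [(i, c)] of [h]. *)
pose B (i : I) := [set u | forall p, p \in h -> p.1 = i -> J p.2 u].
have BE p : p \in h -> B p.1 = J p.2.
  move=> ph; apply/seteqP; split => u /=; first by move/(_ _ ph erefl).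
  move=> Ju p' p'h pp'; suff -> : p' = p by [].
  move: ph p'h uh pp'; elim: (h) => // a l IH.
  rewrite !inE /= => /predU1P[->|pl] /predU1P[->|p'l] /andP[al ul] // E.
  - by move: al; rewrite -E map_f.
  - by move: al; rewrite E map_f.
  - exact: IH.
have mB i : i \in [fset i in unzip1 h]%fset -> measurable (B i).
  by rewrite inE => /mapP[p ph ->]; rewrite BE.
exists (\bigcap_(i in [set` [fset i in unzip1 h]%fset]) (X i @^-1` B i)).
  apply: fin_bigcap_measurable; first exact: finite_fset.
  by move=> i /mB mBi; rewrite -[X in measurable X]setTI; exact: measurable_funP.
split.
  by move=> w hw i _ p ph <-; exact: hw.
rewrite indep // (perm_big (unzip1 h)) /=; last by apply: uniq_perm => // i; rewrite inE.
rewrite big_map -prodEFin big_seq [leRHS]big_seq.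
suff /andP[] : (0 <= \prod_(p <- h | p \in h) P (X p.1 @^-1` B p.1) <=
    \prod_(p <- h | p \in h) (q p.2)%:E)%E by [].
elim/big_ind2 : _ => [|a a' b b' /andP[a0 aa'] /andP[b0 bb']|p ph].
- by rewrite lee01 lexx.
- by rewrite mule_ge0 // lee_pmul.
- by rewrite BE // measure_ge0 Jq.
Qed.

End ProbabilityBounds.

Section ReachProbability.
Context {disp : measure_display} {Omega : measurableType disp} {R : realType}.
Variables (P : probability Omega R) (d : nat) (tau : line d -> {RV P >-> R}).
Variables (K s0 : R).
Hypothesis s0_gt0 : 0 < s0.
Hypothesis tau_indep : mutually_independent tau.
Implicit Types (x y : vertex d) (h : seq (line d * nat)).

Definition threshold (c : nat) : R := s0 / 2 ^+ c.

(* The class [c < k] of a passage time is that of the largest threshold below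
   it; class [k] collects the times below all these thresholds. *)
Definition class (k : nat) (u : R) : nat :=
  find (fun c => threshold c <= u) (iota 0 k).

(** Being of class [c] is relaxed to lying below the previous threshold, an event that does not
    depend on [k]; class 0 imposes nothing. *)
Definition below_class (c : nat) : set R :=
  if c is c'.+1 then [set u | u < threshold c'] else setT.

Hypothesis K_ge0 : 0 <= K.
Hypothesis class_prob : forall (L : line d) c,
  (P (tau L @^-1` below_class c) <= (K * threshold c)%:E)%E.

Lemma threshold_gt0 c : 0 < threshold c.
Proof. by rewrite divr_gt0 // exprn_gt0. Qed.

Lemma threshold_noninc c c' : (c <= c')%N -> threshold c' <= threshold c.
Proof.
move=> cc'; rewrite ler_pM2l // lef_pV2 ?posrE ?exprn_gt0 //.
by rewrite ler_weXn2l // ler1n.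
Qed.

Lemma class_le k u : (class k u <= k)%N.
Proof. by rewrite -{2}(size_iota 0 k) find_size. Qed.

Lemma class_threshold k u : (class k u < k)%N -> threshold (class k u) <= u.
Proof.
move=> ck; have hs : has (fun c => threshold c <= u) (iota 0 k).
  by rewrite has_find size_iota.
by have := nth_find 0%N hs; rewrite nth_iota // add0n.
Qed.

Lemma below_classP k u : below_class (class k u) u.
Proof.
rewrite /below_class; case E : (class k u) => [|c] //=.
have ck : (c < k)%N by rewrite -E class_le.
have := @before_find _ 0%N (fun c => threshold c <= u) (iota 0 k) c.
rewrite -/(class k u) E ltnSn nth_iota // add0n => /(_ isT)/negbT.
by rewrite -ltNge.
Qed.

Lemma measurable_below_class c : measurable (below_class c).
Proof.
by case: c => [|c] //=; exact: (measurable_itv `]-oo, threshold c[).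
Qed.

Definition jumps (N : nat) : seq int :=
  [seq n%:Z | n <- iota 0 N] ++ [seq - n%:Z | n <- iota 0 N].

Lemma mem_jumps N (z : int) : (`|z| < N)%N -> z \in jumps N.
Proof.
move=> zN; rewrite mem_cat; apply/orP; case: (lerP 0 z) => z0.
  by left; apply/mapP; exists `|z|%N; rewrite ?mem_iota //; lia.
by right; apply/mapP; exists `|z|%N; rewrite ?mem_iota //; lia.
Qed.

(** By [1 + q <= expR q], the term at 0, which is [expR (- q)], and the geometric sum of the others
    are each at most [1 / q]. *)
Lemma sum_exp_geometric (q : R) N : 0 < q ->
  \sum_(n <- iota 0 N) expR (- q * (maxn 1 n)%:R) <= 2 / q.
Proof.
move=> q0; have e1 : expR (- q) * q <= 1 - expR (- q).
  rewrite lerBrDr -{2}[expR (- q)]mulr1 -mulrDr expRN mulrC ler_pdivrMr ?expR_gt0 //.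
  by rewrite mul1r addrC expR_ge1Dx.
have e2 : expR (- q) <= 1 / q.
  by rewrite ler_pdivlMr // (le_trans e1)// gerBl expR_ge0.
have pos (n : nat) : 0 <= expR (- q * n%:R) by exact: expR_ge0.
suff H n : \sum_(0 <= i < n) expR (- q * i.+1%:R) <= (1 - expR (- q * n%:R)) / q.
  case: N => [|N]; first by rewrite big_nil divr_ge0 // ltW.
  rewrite /= big_cons mulr1 (_ : 2 = 1 + 1) // mulrDl lerD //.
  rewrite (iotaDl 1 0 N) big_map; apply: le_trans (_ : (1 - expR (- q * N%:R)) / q <= _).
    apply: le_trans (H N); rewrite /index_iota subn0.
    by apply: ler_sum => i _; rewrite add1n (maxn_idPr _).
  by rewrite ler_pM2r ?invr_gt0 // gerBl.
elim: n => [|n IH]; first by rewrite big_geq // mulr0 expR0 subrr mul0r.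
rewrite big_nat_recr //=; apply: le_trans (lerD IH (lexx _)) _.
rewrite ler_pdivlMr // mulrDl divfK ?gt_eqF //.
have -> : expR (- q * n.+1%:R) = expR (- q) * expR (- q * n%:R).
  by rewrite -expRD -natr1 mulrDr mulr1 addrC.
rewrite mulrAC -lerBrDl.
have := ler_wpM2r (pos n) e1; lra.
Qed.

Lemma sum_jumps (lam : R) c N : 0 < lam ->
  \sum_(z <- jumps N) expR (- lam * jump_cost threshold c z) <=
  4 / (lam * threshold c).
Proof.
move=> lam0; have q0 : 0 < lam * threshold c by rewrite mulr_gt0 // threshold_gt0.
rewrite big_cat !big_map /= /jump_cost.
have -> : 4 / (lam * threshold c) =
    2 / (lam * threshold c) + 2 / (lam * threshold c) by rewrite -mulrDl -natrD.
apply: lerD; apply: le_trans (sum_exp_geometric N q0).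
  by apply: ler_sum => n _; rewrite mulrA mulNr.
by apply: ler_sum => n _; rewrite mulrA mulNr abszN.
Qed.

Variables (k : nat) (lam : R).
Hypothesis k_gt0 : (0 < k)%N.
Hypothesis lam_gt0 : 0 < lam.
Hypothesis lam_ge : 16 * d%:R * K * expR 1 * k%:R <= lam.

Let cl (w : Omega) (L : line d) := class k (tau L w).

Let agrees h : set Omega := [set w | forall p, p \in h -> cl w p.1 = p.2].

Let weight h : R := \prod_(p <- h) (K * threshold p.2).

Let end_bound : R := d%:R * (K * threshold k).

Let weight_ge0 h : 0 <= weight h.
Proof. by apply: prodr_ge0 => p _; rewrite mulr_ge0 // ltW // threshold_gt0. Qed.

Let end_bound_ge0 : 0 <= end_bound.
Proof. by rewrite !mulr_ge0 // ltW // threshold_gt0. Qed.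

Let potential_ge0 M h : 0 <= potential R k M h.
Proof. by rewrite (le_trans ler01) // potential_ge1. Qed.

(** The final line is fresh, hence independent of those of [h]: each of the [d] directions brings a
    factor [K * threshold k]. *)
Lemma reach_end_prob h x : uniq (unzip1 h) ->
  prob_le P (agrees h `&` [set w | exists2 i, line_through x i \notin unzip1 h &
    cl w (line_through x i) = k]) (weight h * end_bound).
Proof.
move=> uh; have -> : weight h * end_bound =
    \sum_(i <- enum 'I_d) weight ((line_through x i, k) :: h).
  rewrite big_enum /= [RHS](eq_bigr (fun=> K * threshold k * weight h)); last first.
    by move=> i _; rewrite /weight big_cons.
  by rewrite sumr_const card_ord -mulr_natl /end_bound mulrCA; congr (_ * _); rewrite mulrC.
pose A i := agrees h `&` [set w | line_through x i \notin unzip1 h /\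
    cl w (line_through x i) = k].
apply: (prob_leS (A' := [set w | exists2 i, i \in enum 'I_d & A i w])).
- move=> w [hw [i Lh Lk]]; exists i; first by rewrite mem_enum.
  by split.
- apply: prob_le_bigU => i _.
  have [Lh|Lh] := boolP (line_through x i \in unzip1 h).
    by apply: prob_le0 => // w [_ []]; rewrite Lh.
  apply: (prob_leS (A' := [set w | forall p, p \in (line_through x i, k) :: h ->
      below_class p.2 (tau p.1 w)])).
  + move=> w [hw [_ Lk]] p; rewrite inE => /predU1P[->|ph] /=.
      by rewrite -{1}Lk; exact: below_classP.
    by rewrite -(hw p ph); exact: below_classP.
  have uh' : uniq (unzip1 ((line_through x i, k) :: h)) by rewrite /= Lh.
  exact: (prob_independent_seq tau_indep uh' measurable_below_class class_prob).
Qed.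

(** Invariant of the union bound over chains. The exponential accounts for the remaining budget, and
    the factor 2 leaves half of the bound for ending at once and half for a further jump. *)
Let bound h (b : R) : R :=
  weight h * expR (lam * b) * potential R k 0 h * (2 * end_bound).

Let bound_ge0 h b : 0 <= bound h b.
Proof.
have e2 : 0 <= 2 * end_bound by exact: mulr_ge0.
apply: mulr_ge0 => //; apply: mulr_ge0 => //.
by apply: mulr_ge0 => //; exact: expR_ge0.
Qed.

Lemma end_bound_le h b : 0 <= b -> weight h * end_bound <= bound h b / 2.
Proof.
move=> b0; have -> : bound h b / 2 =
    weight h * end_bound * (expR (lam * b) * potential R k 0 h) by rewrite /bound; field.
apply: ler_peMr; first exact: mulr_ge0.
apply: mulr_ege1; last exact: potential_ge1.
by rewrite -expR0 ler_expR; apply: mulr_ge0 => //; exact: ltW.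
Qed.

(** Summing over jump lengths gives [4 / (lam * threshold c)], which cancels the probability factor
    [K * threshold c] of the fresh line up to [4 * K / lam]. Classes and landing lines are then
    summed by the potential. *)
Lemma sum_jump_bound h (b : R) L N :
  \sum_(c <- enum 'I_k) \sum_(A <- L :: lower_prefix c h) \sum_(z <- jumps N)
    bound ((L, val c) :: h) (b - jump_cost threshold c z) <=
  weight h * expR (lam * b) * (2 * end_bound) * (4 * K / lam) *
    (2 * expR 1 * k%:R * potential R k 0 h).
Proof.
set C := weight h * _ * _ * _.
have W0 : 0 <= weight h * expR (lam * b) * (2 * end_bound).
  apply: mulr_ge0; first by apply: mulr_ge0 => //; exact: expR_ge0.
  exact: mulr_ge0.
have C0 : 0 <= C.
  by apply: mulr_ge0 => //; apply: divr_ge0; [exact: mulr_ge0|exact: ltW].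
apply: le_trans (ler_wpM2l C0 (sum_potential_cons R k_gt0 L h)).
rewrite mulr_sumr big_enum; apply: ler_sum => c _.
set S := \sum_(z <- jumps N) _.
have -> : \sum_(A <- L :: lower_prefix c h) S = (size (lower_prefix c h)).+1%:R * S.
  by rewrite big_const_seq count_predT iter_addr_0 mulr_natl.
rewrite mulrCA ler_wpM2l //.
have -> : S = weight h * expR (lam * b) * (2 * end_bound) *
    potential R k 0 ((L, val c) :: h) * (K * threshold c) *
    \sum_(z <- jumps N) expR (- lam * jump_cost threshold c z).
  rewrite /S mulr_sumr; apply: eq_bigr => z _; rewrite /bound /weight big_cons /=.
  by rewrite mulrBr expRD -mulNr; ring.
set V := potential _ _ _ _.
have V0 : 0 <= V by exact: potential_ge0.
apply: (@le_trans _ _ (weight h * expR (lam * b) * (2 * end_bound) * V *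
    (K * threshold c) * (4 / (lam * threshold c)))).
  apply: ler_wpM2l; last exact: sum_jumps.
  apply: mulr_ge0; first exact: mulr_ge0.
  by apply: mulr_ge0 => //; rewrite ltW // threshold_gt0.
have t0 := threshold_gt0 c; rewrite le_eqVlt; apply/orP; left; apply/eqP.
rewrite /C; field.
by rewrite !gt_eqF.
Qed.

(** Induction on the number of jumps, with a union bound over the direction, class, landing line and
    length of the first jump. *)
Lemma reach_prob m h x (b : R) : uniq (unzip1 h) ->
  prob_le P (agrees h `&` [set w | reach k threshold (cl w) m h x b]) (bound h b).
Proof.
elim: m h x b => [|m IH] h x b uh; (have [b0|b0] := ltP b 0;
  first by apply: prob_le0 => // w [_ [/(lt_le_trans b0)]]; rewrite ltxx).
  apply: prob_leW (le_trans (end_bound_le h b0) _) (prob_leS _ (reach_end_prob x uh)).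
    by have := bound_ge0 h b; lra.
  by move=> w [hw [_ []]].
pose T i (c : 'I_k) A z := [set w | line_through x i \notin unzip1 h] `&`
  (agrees ((line_through x i, val c) :: h) `&`
   [set w | reach k threshold (cl w) m ((line_through x i, val c) :: h)
      (point_at A (x 0 (line_dir A) + z)) (b - jump_cost threshold c z)]).
(* A jump costs at least [threshold k] per unit of length, so the budget [b] leaves finitely many
   values of [z]. *)
pose N := Num.bound `|b / threshold k|.
have TP : prob_le P [set w | exists2 i, i \in enum 'I_d & exists2 c, c \in enum 'I_k &
    exists2 A, A \in line_through x i :: lower_prefix c h &
    exists2 z, z \in jumps N & T i c A z w]
    (\sum_(i <- enum 'I_d) \sum_(c <- enum 'I_k)
     \sum_(A <- line_through x i :: lower_prefix c h) \sum_(z <- jumps N)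
     bound ((line_through x i, val c) :: h) (b - jump_cost threshold c z)).
  apply: prob_le_bigU => i _; apply: prob_le_bigU => c _.
  apply: prob_le_bigU => A _; apply: prob_le_bigU => z _.
  have [Lh|Lh] := boolP (line_through x i \in unzip1 h).
    by apply: prob_le0 => // w [] /=; rewrite Lh.
  apply: prob_leS (IH _ _ _ _); first by move=> w [_]; apply.
  by rewrite /= Lh.
apply: prob_leW _ (prob_leS _ (prob_leU (reach_end_prob x uh) TP)); last first.
  move=> w [hw [_ [|[i [Lh Lk [A [z [AL r]]]]]]]]; first by left.
  right; exists i; first by rewrite mem_enum.
  exists (Ordinal Lk); first by rewrite mem_enum.
  exists A => //; exists z; last first.
    by do 2?split => //; move=> p; rewrite inE => /predU1P[->//|/hw].
  apply: mem_jumps.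
  have b1 : 0 <= b - jump_cost threshold (cl w (line_through x i)) z.
    by case: (m) r => [|?] [].
  have zb : `|z|%:R <= b / threshold k.
    rewrite ler_pdivlMr ?threshold_gt0 // mulrC.
    rewrite subr_ge0 in b1; apply: le_trans b1.
    apply: ler_pM => //; first by rewrite ltW // threshold_gt0.
      exact/threshold_noninc/ltnW.
    by rewrite ler_nat leq_maxr.
  rewrite -(ltr_nat R) (le_lt_trans zb) //.
  by rewrite (le_lt_trans (ler_norm _)) // archi_boundP.
have -> : bound h b = bound h b / 2 + bound h b / 2 by field.
apply: lerD; first exact: end_bound_le.
apply: (@le_trans _ _ (\sum_(i <- enum 'I_d) (weight h * expR (lam * b) *
    (2 * end_bound) * (4 * K / lam) * (2 * expR 1 * k%:R * potential R k 0 h)))).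
  by apply: ler_sum => i _; exact: sum_jump_bound.
rewrite big_enum sumr_const card_ord.
have -> : (weight h * expR (lam * b) * (2 * end_bound) * (4 * K / lam) *
    (2 * expR 1 * k%:R * potential R k 0 h)) *+ d =
    bound h b * (8 * d%:R * K * expR 1 * k%:R / lam).
  by rewrite -[LHS]mulr_natl /bound; field; rewrite gt_eqF.
(* The constant 16 in [lam_ge] is chosen to make this factor at most one half. *)
rewrite ler_wpM2l // ler_pdivrMr // -[leLHS](_ : 2^-1 * (16 * d%:R * K * expR 1 * k%:R) = _).
  by rewrite ler_wpM2l // invr_ge0.
by field.
Qed.

End ReachProbability.

(** * Almost sure bounds on the length of cheap walks *)

Section NoExplosion.
Context {disp : measure_display} {Omega : measurableType disp} {R : realType}.
Variables (P : probability Omega R) (d : nat) (tau : line d -> {RV P >-> R}).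
Variables (K s0 : R).
Hypothesis d_gt0 : (0 < d)%N.
Hypothesis s0_gt0 : 0 < s0.
Hypothesis K_gt0 : 0 < K.
Hypothesis tau_ge0 : forall L w, 0 <= tau L w.
Hypothesis tau_indep : mutually_independent tau.
Hypothesis class_prob : forall (L : line d) c,
  (P (tau L @^-1` below_class s0 c) <= (K * threshold s0 c)%:E)%E.

Let rate : R := 16 * d%:R * K * expR 1.

(* [expR (rate * eps) = 3 / 2] is beaten by the factor [2] between thresholds. *)
Let eps : R := ln (3 / 2) / rate.

Let rate_gt0 : 0 < rate.
Proof. by rewrite !mulr_gt0 ?expR_gt0 ?ltr0n. Qed.

Lemma eps_gt0 : 0 < eps.
Proof. by rewrite divr_gt0 // ln_gt0 //; lra. Qed.

(** A walk of cost at most [eps] on lines of class below [k] pays at least [threshold s0 k] per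
    step, which bounds its length. *)
Let size_bound (k : nat) : nat := Num.bound `|eps / threshold s0 k|.

Let fast (k : nat) x : set Omega :=
  [set w | reach k (threshold s0) (fun L => class s0 k (tau L w)) (size_bound k) [::] x eps].

Lemma fast_prob k x :
  prob_le P (fast k.+1 x) (3 * d%:R * K * s0 / 2 * (3 / 4) ^+ k).
Proof.
(* [rate * k.+1] is the least value of [lam] that [reach_prob] admits for class [k.+1]. *)
have lam0 : 0 < rate * k.+1%:R by rewrite mulr_gt0.
have := @reach_prob _ _ _ P d tau K s0 s0_gt0 tau_indep (ltW K_gt0) class_prob
  k.+1 _ (ltn0Sn k) lam0 (lexx _) (size_bound k.+1) [::] x eps isT.
rewrite big_nil /= !mul1r mulr1 => H; apply: prob_leS (prob_leW _ H) => //.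
have -> : expR (rate * k.+1%:R * eps) = (3 / 2) ^+ k.+1.
  rewrite mulrC mulrA divfK ?gt_eqF // mulrC expRM_natl lnK // posrE; lra.
rewrite /threshold [(3 / 4) ^+ k](_ : _ = (3 / 2) ^+ k / 2 ^+ k); last first.
  by rewrite -expr_div_n; congr (_ ^+ _); field.
rewrite !exprS le_eqVlt; apply/orP; left; apply/eqP; field.
by rewrite expf_neq0.
Qed.

(** Meeting a line of class [k] within the budget would yield a chain by [fast_line_reach];
    otherwise every line is slow and [size_bound] applies. *)
Lemma size_le_of_not_fast k x w s : ~ fast k x w ->
  walk_cost (fun L => tau L w) x s <= eps -> (size s <= size_bound k)%N.
Proof.
move=> nfast cs.
have slow_size s1 : walk_cost (fun L => tau L w) x s1 <= eps ->
    (forall L, L \in walk_lines x s1 -> (class s0 k (tau L w) < k)%N) ->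
    (size s1 <= size_bound k)%N.
  move=> cs1 slow; rewrite -(ler_nat R) ltW //.
  apply: le_lt_trans (archi_boundP (normr_ge0 _)); apply: le_trans (ler_norm _).
  rewrite ler_pdivlMr ?threshold_gt0 // mulrC; apply: le_trans cs1.
  apply: walk_cost_ge_size => L /slow Lk; apply: le_trans (class_threshold Lk).
  exact/threshold_noninc/ltnW.
apply: (slow_size s) => // L Ls; rewrite ltn_neqAle class_le andbT; apply/eqP => Lk.
apply: nfast; apply: (@fast_line_reach _ _ _ _ (fun L => tau L w) _ _ _ _ x s) => //.
- by move=> c; rewrite ltW // threshold_gt0.
- exact: threshold_noninc.
- by move=> L'; exact: class_threshold.
- by move=> L'; exact: class_le.
- by exists L.
Qed.

Lemma fast_negligible x : P.-negligible (\bigcap_k fast k.+1 x).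
Proof.
have /choice[B BP] : forall k, exists B, measurable B /\ fast k.+1 x `<=` B /\
    (P B <= (3 * d%:R * K * s0 / 2 * (3 / 4) ^+ k)%:E)%E.
  by move=> k; have [B mB [fB PB]] := fast_prob k x; exists B.
have mB : measurable (\bigcap_k B k).
  by apply: bigcapT_measurable => k; have [] := BP k.
exists (\bigcap_k B k); split => //; last first.
  by move=> w fw k _; have [_ [fB _]] := BP k; apply/fB/fw.
have PBfin : P (\bigcap_k B k) = (fine (P (\bigcap_k B k)))%:E.
  by rewrite fineK // fin_num_measure.
apply/eqP; rewrite eq_le measure_ge0 andbT PBfin lee_fin leNgt; apply/negP => PB0.
have geo : `|3 / 4 : R| < 1 by rewrite ger0_norm; lra.
have := @cvg_geometric R (3 * d%:R * K * s0 / 2) _ geo.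
move=> /cvgrPdist_lt /(_ _ PB0) [k _ /(_ k (leqnn k))] /=.
rewrite sub0r normrN => lt_k.
have [mBk [_ PBk]] := BP k.
have : (P (\bigcap_k B k) <= (3 * d%:R * K * s0 / 2 * (3 / 4) ^+ k)%:E)%E.
  by apply: le_trans PBk; rewrite le_measure ?inE //; exact: bigcap_inf.
rewrite PBfin lee_fin leNgt; move/negP; apply.
exact: le_lt_trans (ler_norm _) lt_k.
Qed.

Lemma short_walks_negligible : P.-negligible (~` [set w | forall x, exists n, forall s,
  walk_cost (fun L => tau L w) x s <= eps -> (size s <= n)%N]).
Proof.
(* Vertices are enumerated by their codes, to reduce to a countable union of negligible events. *)
pose bad (n : nat) : set Omega :=
  if choice.unpickle n is Some x then \bigcap_k fast k.+1 (x : vertex d) else set0.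
apply: (@negligibleS _ _ _ _ (\bigcup_n bad n)); last first.
  apply: negligible_bigcup => n; rewrite /bad; case: choice.unpickle => [x|].
    exact: fast_negligible.
  exact: negligible_set0.
move=> w /= /existsNP[x xP]; exists (choice.pickle x) => //; rewrite /bad choice.pickleK => k _.
by apply: contrapT => nf; apply: xP; exists (size_bound k.+1) => s; exact: size_le_of_not_fast.
Qed.

End NoExplosion.

(** * Geodesics as cheapest walks, and measurability *)

Section Geodesics.
Context {disp : measure_display} {Omega : measurableType disp} {R : realType}.
Variables (P : probability Omega R) (d : nat) (tau : line d -> {RV P >-> R}).
Hypothesis tau_ge0 : forall L w, 0 <= tau L w.
Implicit Types (x y : vertex d) (s : seq ('I_d * bool)).

Lemma passage_time_walk x s w :
  passage_time tau (walk_edges x s) w = walk_cost (fun L => tau L w) x s.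
Proof.
rewrite /passage_time /walk_cost; elim: s x => [|st s IH] x; first by rewrite !big_nil.
by rewrite /= !big_cons line_of_edge_of_step IH.
Qed.

Lemma geodesic_walk x y w : (exists G, geodesic tau x y w G) <->
  exists s, [/\ nonbacktracking x s, foldl step x s = y &
    forall s', nonbacktracking x s' -> foldl step x s' = y ->
      walk_cost (fun L => tau L w) x s <= walk_cost (fun L => tau L w) x s'].
Proof.
pose T := [set passage_time tau G w | G in path_from_to x y].
(* [inf] is a genuine infimum only for nonempty sets bounded below; nonnegativity provides the lower
   bound. *)
have T0 : lbound T 0 by move=> _ [G _ <-]; exact: sumr_ge0.
split.
- move=> [G [/path_from_toP[s [bs sy ->]]]]; rewrite passage_time_walk => sE.
  exists s; split => // s' bs' sy'; rewrite sE -passage_time_walk.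
  apply: ge_inf; first by exists 0.
  by exists (walk_edges x s') => //; apply/path_from_toP; exists s'.
- move=> [s [bs sy smin]]; have ps : path_from_to x y (walk_edges x s).
    by apply/path_from_toP; exists s.
  exists (walk_edges x s); split => //.
  apply/eqP; rewrite eq_le; apply/andP; split.
    apply: lb_le_inf; first by exists (passage_time tau (walk_edges x s) w), (walk_edges x s).
    move=> _ [G /path_from_toP[s' [bs' sy' ->]] <-]; rewrite !passage_time_walk.
    exact: smin.
  by apply: ge_inf; [exists 0|exists (walk_edges x s)].
Qed.

Lemma measurable_walk_cost_le x s s' : measurable
  [set w | walk_cost (fun L => tau L w) x s <= walk_cost (fun L => tau L w) x s'].
Proof.
have := @measurable_fun_ler _ _ R setT
  (fun w => walk_cost (fun L => tau L w) x s) (fun w => walk_cost (fun L => tau L w) x s').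
move=> /(_ _ _ measurableT [set true] I)/wrap[||]; try by apply: measurable_sum => L.
by rewrite setTI.
Qed.

Lemma measurable_forall (T : countType) (A : T -> set Omega) :
  (forall i, measurable (A i)) -> measurable [set w | forall i, A i w].
Proof.
move=> mA; rewrite -[X in measurable X]setCK.
rewrite (_ : ~` [set w | _] = \bigcup_i ~` A i).
  apply: measurableC; apply: countable_bigcupT_measurable => [|i]; first exact: countableP.
  exact: measurableC.
apply/seteqP; split => w /=; first by move=> /existsNP[i Ai]; exists i.
by move=> [i _ Ai] /(_ i).
Qed.

Lemma measurable_Prop (Q : Prop) : measurable [set w : Omega | Q].
Proof.
have [q|nq] := pselect Q; [rewrite (_ : mkset _ = setT)|rewrite (_ : mkset _ = set0)] => //.
- by apply/seteqP; split.
- by apply/seteqP; split.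
Qed.

Lemma measurable_imply (Q : Prop) (A : set Omega) :
  measurable A -> measurable [set w | Q -> A w].
Proof.
move=> mA; rewrite (_ : mkset _ = [set w | ~ Q] `|` A); last first.
  apply/seteqP; split => w /=; last by case.
  by have [q /(_ q)|] := pselect Q; [right|left].
exact/measurableU/mA/measurable_Prop.
Qed.

(** Walks are countably many, so the event is built by countable operations from comparisons between
    finite sums of passage times. *)
Lemma measurable_geodesics :
  measurable [set w | forall x y, exists G, geodesic tau x y w G].
Proof.
suff H x y : measurable [set w | exists G, geodesic tau x y w G].
  apply: (measurable_forall (A := fun x => [set w | forall y, _])) => x.
  exact: (measurable_forall (A := fun y => [set w | exists G, geodesic tau x y w G])).
rewrite (_ : [set w | _] = \bigcup_s ([set w | nonbacktracking x s /\ foldl step x s = y] `&`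
    [set w | forall s', [set w | nonbacktracking x s' -> foldl step x s' = y ->
      walk_cost (fun L => tau L w) x s <= walk_cost (fun L => tau L w) x s'] w])).
  apply: countable_bigcupT_measurable => [|s]; first exact: countableP.
  apply: measurableI.
    exact: measurable_Prop.
  apply: (measurable_forall (A := fun s' => [set w | nonbacktracking x s' -> _ -> _])) => s'.
  apply: (@measurable_imply _ [set w | _ -> _]).
  apply: (@measurable_imply _ [set w | _ <= _]).
  exact: measurable_walk_cost_le.
apply/seteqP; split => w /=.
  by move=> /geodesic_walk[s [bs sy smin]]; exists s.
by move=> [s _ [[bs sy] smin]]; apply/geodesic_walk; exists s.
Qed.

(** Off the negligible set, any fixed nonbacktracking walk from [x] to [y] has a cost that bounds
    the length of its competitors. *)
Lemma geodesics_prob1 (eps : R) : 0 < eps ->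
  P.-negligible (~` [set w | forall x, exists n, forall s,
    walk_cost (fun L => tau L w) x s <= eps -> (size s <= n)%N]) ->
  P [set w | forall x y, exists G, geodesic tau x y w G] = 1%E.
Proof.
move=> eps0 negl; set A := [set w | _].
have mA : measurable A by exact: measurable_geodesics.
suff : P (~` A) = 0%E.
  move=> PA; rewrite -[A]setCK probability_setC; last exact: measurableC.
  by rewrite PA sube0.
apply: measure_negligible; first exact: measurableC.
apply: negligibleS negl => w; apply: contra_not => short x y.
apply/geodesic_walk; have [s0 bs0 sy0] := nonbacktracking_exists x y.
have [n nP] := bounded_size eps0 short
  (walk_cost (fun L => tau L w) x s0) x.
exact: cheapest_walk_exists bs0 sy0 nP.
Qed.

End Geodesics.

(** * From the distribution function to the theorem *)

Lemma class_prob_of_cdf (disp : measure_display) (Omega : measurableType disp)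
    (R : realType) (P : probability Omega R) (d : nat) (tau : line d -> {RV P >-> R})
    (F : R -> R) (K s0 : R) :
  (forall L t, cdf (tau L) t = (F t)%:E) -> 0 < s0 ->
  (forall t, 0 < t <= s0 -> F t <= K * t) ->
  exists2 K', 0 < K' & forall L c,
    (P (tau L @^-1` below_class s0 c) <= (K' * threshold s0 c)%:E)%E.
Proof.
(* [s0^-1] makes the bound trivial for class 0; the factor 2 is the ratio of successive thresholds,
   since [below_class] uses the preceding one. *)
move=> cdfE s0_gt0 FK; exists (Num.max (2 * K) s0^-1).
  by rewrite lt_max invr_gt0 s0_gt0 orbT.
move=> L.
have preimage_measurable c : measurable (tau L @^-1` below_class s0 c).
  rewrite -[X in measurable X]setTI; apply: measurable_funP => //.
  exact: measurable_below_class.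
case=> [|c].
  apply: le_trans (probability_le1 _ _) _.
    exact: preimage_measurable 0.
  rewrite lee_fin /threshold expr0 divr1 -ler_pdivrMr // mul1r.
  by rewrite le_max lexx orbT.
have t0 : 0 < threshold s0 c by rewrite threshold_gt0.
apply: (@le_trans _ _ (cdf (tau L) (threshold s0 c))).
  rewrite /cdf /distribution /pushforward le_measure ?inE //.
  - by rewrite -[X in measurable X]setTI; exact: measurable_funP.
  - by move=> w /= /ltW; rewrite in_itv.
rewrite cdfE lee_fin; apply: (@le_trans _ _ (K * threshold s0 c)).
  apply: FK; rewrite t0 /=; apply: le_trans (threshold_noninc s0_gt0 (leq0n c)) _.
  by rewrite /threshold expr0 divr1.
have -> : K * threshold s0 c = 2 * K * threshold s0 c.+1.
  by rewrite /threshold exprS; field; rewrite expf_neq0.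
by rewrite ler_pM2r ?threshold_gt0 // le_max lexx.
Qed.

Theorem proposition2p1 (R : realType) (disp : measure_display)
    (Omega : measurableType disp) (P : probability Omega R)
    (d : nat) (hd : (2 <= d)%N)
    (tau : line d -> {RV P >-> R})
    (tau_ge0 : forall (L : line d) (w : Omega), 0 <= tau L w)
    (tau_indep : mutually_independent tau)
    (F : R -> R)
    (tau_cdf : forall (L : line d) (t : R), cdf (tau L) t = (F t)%:E)
    (a : R) (a_ge0 : 0 <= a)
    (a_inf_support :
      forall eps : R, 0 < eps -> 0 < F (a + eps) /\ F (a - eps) = 0)
    (hF : 0 < a \/
      (a = 0 /\ exists beta c : R, [/\ 1 <= beta, 0 < c &
         F t / (c * t `^ beta) @[t --> 0^'+] --> (1 : R)])) :
  let geodesics_exist : set Omega :=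
    [set w | forall x y : vertex d, exists G, geodesic tau x y w G] in
  measurable geodesics_exist /\ P geodesics_exist = 1%E.
Proof.
move=> geodesics_exist; split; first exact: measurable_geodesics.
have [K [s0 s0_gt0 FK]] : exists K, exists2 s0, 0 < s0 &
    forall t, 0 < t <= s0 -> F t <= K * t.
  case: hF => [a0|[_ [beta [c [beta1 c0]]]]].
    (* [F] vanishes below [a], so [K = 0] works. *)
    exists 0, (a / 2) => [|t /andP[t0 ta]]; first by rewrite divr_gt0.
    have [|_] := a_inf_support (a - t); first by lra.
    by rewrite opprB addrCA subrr addr0 mul0r => ->.
  move=> /cvgrPdist_lt /(_ 1 ltr01)[e /= e0 He].
  exists (2 * c), (Num.min (e / 2) 1) => [|t /andP[t0]].
    by rewrite lt_min divr_gt0 // ltr01.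
  rewrite le_min => /andP[te t1].
  have te' : `|0 - t| < e by rewrite sub0r normrN gtr0_norm //; lra.
  have tb0 : 0 < t `^ beta by exact: powR_gt0.
  have tb : t `^ beta <= t.
    have t01 : 0 < t <= 1 by rewrite t0.
    by have := ger_powR t01 beta1; rewrite powRr1 // ltW.
  have := He t te' t0; rewrite ltr_norml => /andP[lt2 _].
  have {lt2} : F t / (c * t `^ beta) <= 2 by lra.
  rewrite ler_pdivrMr ?mulr_gt0 // => /le_trans; apply.
  by rewrite mulrA ler_wpM2l // mulr_ge0 // ltW.
have [K' K'0 classP] := class_prob_of_cdf tau_cdf s0_gt0 FK.
have d0 : (0 < d)%N by exact: leq_trans hd.
apply: (geodesics_prob1 tau_ge0 (eps_gt0 d0 K'0)).
exact: short_walks_negligible d0 s0_gt0 K'0 tau_ge0 tau_indep classP.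
Qed.
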